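(* Let $q\ge 2$ and $m\ge 1$ be fixed integers. For integers $n\ge m$ let $c^{\rm coord}_q(n,m)$ denote the number of different unordered partitions of the hypercube ${\bf Z}_q^n$ into $q^m$ subcubes of dimension $n-m$ each. Then, as $n\to\infty$, $$c^{\rm coord}_q(n,m)\sim n^{\frac{q^m-1}{q-1}}.$$
   Context: A $d$-dimensional subcube of ${\bf Z}_q^n$ is a subset of ${\bf Z}_q^n$ obtained by fixing the values of some $n-d$ coordinates and letting each of the remaining $d$ coordinates run through all of ${\bf Z}_q$. A partition into subcubes is a collection of subcubes such that each vector of ${\bf Z}_q^n$ lies in exactly one of them. *)

(* Defs.v *)
From mathcomp Require Import all_boot.
Unset Printing Implicit Defensive.

(* Z_q^n is modelled as the finite type of functions 'I_n -> 'I_q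
   ('I_q is a set with q elements standing for Z_q; only its cardinality
   matters for subcubes). *)
Definition vec (q n : nat) := {ffun 'I_n -> 'I_q}.

Definition is_subcube (q n d : nat) (C : {set vec q n}) : bool :=
  [exists S : {set 'I_n}, exists a : vec q n,
     (#|S| + d == n) && (C == [set x : vec q n | [forall i in S, x i == a i]])].

Definition is_subcube_partition (q n d : nat) (P : {set {set vec q n}}) : bool :=
  [forall C in P, is_subcube q n d C] &&
  [forall x : vec q n, #|[set C in P | x \in C]| == 1].

Definition c_coord (q n m : nat) : nat :=
  #|[set P : {set {set vec q n}} |
       (#|P| == q ^ m) && is_subcube_partition q n (n - m) P]|.

(* Main.v *)
Require Import Defs.
From mathcomp Require all_boot zify.
From Stdlib Require Import Reals Lra Lia.
From Coquelicot Require Coquelicot.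

(** A decision tree of depth [m] whose inner nodes are labelled by coordinates
    partitions Z_q^n into q^m subcubes of codimension [m]; it has
    N = (q^m - 1)/(q - 1) inner nodes, which gives the order n^N.

    For the upper bound, a partition [P] in which exactly [v] coordinates are
    fixed somewhere satisfies |P| >= (q - 1) v + 1 (a q-ary form of Tarsi's lemma
    on minimally unsatisfiable formulas, via a Hall-type strengthening
    relative to subfamilies). Hence v <= N when |P| = q^m, and the
    partitions with v < N number only O(n^(N-1)). If v = N, exactly one
    coordinate, the root, is fixed in all the subcubes of [P]: existence is by
    induction, restricting along a coordinate that is fixed in the fewest
    subcubes. A partition with a distinguished root amounts to the root together
    with [q] partitions in the remaining coordinates, so up to O(n^(N-1)) one
    gets c(n, m) = n c(n-1, m-1)^q, and induction on [m] gives
    (n - K)^N <= c(n, m) <= (n + K)^N with [K] independent of [n]. *)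

(** * Numerical estimates for the recursion on the depth *)

Section Nodes.
Import all_boot zify.
Set Implicit Arguments.
Unset Strict Implicit.

(** The number (q^m - 1)/(q - 1) of inner nodes of the complete q-ary tree of depth [m]. *)
Fixpoint nodes q m := if m is m'.+1 then 1 + q * nodes q m' else 0.

Lemma leq_expn m n e : m <= n -> m ^ e <= n ^ e.
Proof. by case: e => // e; rewrite leq_exp2r. Qed.

Lemma nodesE q m : 0 < q -> q ^ m = (q.-1 * nodes q m).+1.
Proof.
case: q => // q _; elim: m => [|m IHm] /=; first by rewrite expn0 muln0.
by rewrite expnS IHm; nia.
Qed.

Lemma bin_leq_expn n k : 'C(n, k) <= n ^ k.
Proof.
apply: leq_trans (_ : n ^_ k <= _); first by rewrite -bin_ffact leq_pmulr ?fact_gt0.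
elim: k => [|k IHk]; rewrite ?ffactn0 // ffactnSr expnSr leq_mul ?leq_subr //.
Qed.

(** One factor on the right splits as [u] plus a constant: the first summand dominates [S], the
    second the error term. *)
Lemma recursion_upper u K C M x S : S <= u * (u.-1 + K) ^ M ->
  x <= S + C * u.+1 ^ M -> x <= (u + (K + C).+1) ^ M.+1.
Proof.
move=> hS hx; apply: (leq_trans hx); apply: (leq_trans (leq_add hS (leqnn _))).
rewrite expnS mulnDl; apply: leq_add; apply: leq_mul; rewrite ?leq_expn //; lia.
Qed.

Lemma recursion_lower u K C M x S : u * (u.-1 - K) ^ M <= S ->
  S <= x + C * u.+1 ^ M -> (u - (2 * K + 3 + C * 2 ^ M)) ^ M.+1 <= x.
Proof.
move=> hS hx; have [uK|uK] := leqP u (2 * K + 3 + C * 2 ^ M).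
  by move: uK; rewrite -subn_eq0 => /eqP->; rewrite exp0n.
(* The part [2 * K + 3] of the constant gives [u.+1 <= 2 * (u.-1 - K)]; the part [C * 2 ^ M] then
   absorbs the error. *)
have h : C * u.+1 ^ M <= C * 2 ^ M * (u.-1 - K) ^ M.
  by rewrite -mulnA -expnMn; apply: leq_mul => //; apply: leq_expn; lia.
rewrite expnS; apply: (@leq_trans ((u - C * 2 ^ M) * (u.-1 - K) ^ M)).
  by apply: leq_mul; [lia | apply: leq_expn; lia].
rewrite mulnBl leq_subLR addnC; apply: leq_trans hS _; apply: leq_trans hx _.
by rewrite leq_add2l.
Qed.

End Nodes.

(** * Subcubes as partial assignments, and their restriction *)

Section Cubes.
Import all_boot zify.
Set Implicit Arguments.
Unset Strict Implicit.
Variables I A : finType.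

(** A subcube is encoded by its fixed coordinates and their values; a free
    coordinate is sent to [None]. *)
Definition cube := {ffun I -> option A}.
Definition point := {ffun I -> A}.

Implicit Types (x : point) (f g : cube) (P Q F : {set cube}) (i j : I) (c d : A)
  (U : {set I}) (m : nat).

Definition inc x f := [forall i, if f i is Some c then x i == c else true].
Definition dom f : {set I} := [set i | f i].
Definition vars P := \bigcup_(f in P) dom f.
Definition is_partition P := [forall x, #|[set f in P | inc x f]| == 1].

Definition upd x i c : point := [ffun j => if j == i then c else x j].
Definition erase i f : cube := [ffun j => if j == i then None else f j].
Definition free i P := [set f in P | ~~ f i].
Definition fixing i c P := [set f in P | f i == Some c].
(** The trace of [P] on the hyperplane x_i = c, with [i] then freed. The ambient type [I] stays the
    same, so that inductions run on [vars]. *)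
Definition restr i c P := free i P :|: erase i @: fixing i c P.

Lemma incP x f : reflect (forall i c, f i = Some c -> x i = c) (inc x f).
Proof.
apply: (iffP forallP) => [h i c e|h i]; first by move: (h i); rewrite e => /eqP.
by case e: (f i) => [c|] //; rewrite (h i c e).
Qed.

Lemma partition_ex P x : is_partition P -> exists2 f, f \in P & inc x f.
Proof.
move=> /forallP/(_ x)/cards1P[f /setP/(_ f)]; rewrite !inE eqxx => /andP[? ?].
by exists f.
Qed.

Lemma partition_uniq P x f g :
  is_partition P -> f \in P -> g \in P -> inc x f -> inc x g -> f = g.
Proof.
move=> /forallP/(_ x)/cards1P[h e] fP gP xf xg.
move/setP: e => e; have := e f; have := e g; rewrite !inE fP gP xf xg /=.
by move=> /esym/eqP-> /esym/eqP->.
Qed.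

Lemma partitionP P :
  (forall x, exists2 f, f \in P & inc x f) ->
  (forall x f g, f \in P -> g \in P -> inc x f -> inc x g -> f = g) ->
  is_partition P.
Proof.
move=> ex un; apply/forallP => x; have [f fP xf] := ex x.
apply/cards1P; exists f; apply/setP => g; rewrite !inE.
apply/andP/eqP => [[gP xg]|-> //]; exact: (un x).
Qed.

Lemma domP i f : reflect (exists c, f i = Some c) (i \in dom f).
Proof. by rewrite inE; case: (f i) => [c|]; constructor; [exists c | case]. Qed.

Lemma domNP i f : i \notin dom f -> f i = None.
Proof. by rewrite inE; case: (f i). Qed.

Lemma varsP j P : reflect (exists2 f, f \in P & j \in dom f) (j \in vars P).
Proof. exact: bigcupP. Qed.

Lemma varsS P Q : P \subset Q -> vars P \subset vars Q.
Proof.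
move=> /subsetP PQ; apply/subsetP => j /varsP[f fP jf].
by apply/varsP; exists f => //; apply: PQ.
Qed.

Lemma dom_erase i f : dom (erase i f) = dom f :\ i.
Proof. by apply/setP => j; rewrite !inE ffunE; case: eqP. Qed.

Lemma erase_id i f : i \notin dom f -> erase i f = f.
Proof. by move=> /domNP fi; apply/ffunP => j; rewrite ffunE; case: eqP => // ->. Qed.

Lemma inc_upd x i c f :
  inc (upd x i c) f = inc x (erase i f) && ((f i == None) || (f i == Some c)).
Proof.
apply/incP/andP => [h|[/incP h1 h2] j d].
  split; last first.
    by case e: (f i) => [d|] //=; rewrite -(h _ _ e) ffunE eqxx.
  apply/incP => j d; rewrite ffunE; case: eqP => // ij e.
  by rewrite -(h _ _ e) ffunE; move/eqP/negbTE: ij => ->.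
rewrite ffunE; case: eqP => [->|/eqP/negbTE ij] e; last first.
  by apply: h1; rewrite ffunE ij.
by move: h2; rewrite e /= => /eqP [].
Qed.

Lemma inc_erase x i f : inc x f -> inc x (erase i f).
Proof.
by move=> /incP h; apply/incP => j d; rewrite ffunE; case: eqP => // _; apply: h.
Qed.

Lemma inc_updN x i c f : i \notin dom f -> inc (upd x i c) f = inc x f.
Proof. by move=> h; rewrite inc_upd erase_id // (domNP h) andbT. Qed.

Lemma in_free i P f : (f \in free i P) = (f \in P) && (i \notin dom f).
Proof. by rewrite !inE. Qed.

Lemma free_sub i P : free i P \subset P.
Proof. by apply/subsetP => f; rewrite in_free => /andP[]. Qed.

Lemma restrP i c P g :
  reflect (exists2 f, f \in P /\ ((f i == None) || (f i == Some c)) & g = erase i f)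
          (g \in restr i c P).
Proof.
rewrite /restr in_setU; apply: (iffP orP).
  case; first by rewrite in_free => /andP[gP ig]; exists g; rewrite ?erase_id ?domNP.
  by case/imsetP => f; rewrite inE => /andP[fP fi] ->; exists f; rewrite ?fi ?orbT.
case=> f [fP /orP[/eqP fi|fi]] ->.
  have idf : i \notin dom f by rewrite inE fi.
  by left; rewrite erase_id // in_free fP.
by right; apply: imset_f; rewrite inE fP.
Qed.

Lemma is_partition_restr i c P : is_partition P -> is_partition (restr i c P).
Proof.
move=> pP; apply: partitionP => [x|x g1 g2].
  have [f fP] := partition_ex (upd x i c) pP; rewrite inc_upd => /andP[xf fi].
  by exists (erase i f) => //; apply/restrP; exists f.
move=> /restrP[f1 [f1P e1] ->] /restrP[f2 [f2P e2] ->] h1 h2; congr erase.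
by apply: (partition_uniq (x := upd x i c) pP); rewrite // inc_upd ?h1 ?h2.
Qed.

Lemma vars_restr i c P : vars (restr i c P) \subset vars P :\ i.
Proof.
apply/subsetP => j /varsP[_ /restrP[f [fP _] ->]]; rewrite dom_erase !inE.
by case/andP=> -> jf; apply/varsP; exists f; rewrite ?inE.
Qed.

Lemma card_vars_restr i c P : i \in vars P -> #|vars (restr i c P)| < #|vars P|.
Proof.
move=> iP; rewrite (cardsD1 i (vars P)) iP ltnS; exact/subset_leq_card/vars_restr.
Qed.

Lemma free_sub_restr i c P : free i P \subset restr i c P.
Proof. exact: subsetUl. Qed.

Lemma mem_vars_restr i c P f j :
  f \in fixing i c P -> j \in dom f -> j != i -> j \in vars (restr i c P).
Proof.
move=> fB jf ji; apply/varsP; exists (erase i f); last by rewrite dom_erase in_setD1 ji.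
by apply/setUP; right; apply: imset_f.
Qed.

Variable c0 : A.

Lemma inc_ex f : exists x, inc x f.
Proof. by exists [ffun i => odflt c0 (f i)]; apply/incP => i c; rewrite ffunE => ->. Qed.

(** Move a point of a subcube that fixes [i] to x_i = c. A subcube free in [i] around the new point
    would contain the old one too, against uniqueness. *)
Lemma fixing_ex i c P :
  is_partition P -> i \in vars P -> exists f, f \in fixing i c P.
Proof.
move=> pP /varsP[f fP idf]; have [x xf] := inc_ex f.
have [g gP xg] := partition_ex (upd x i c) pP; exists g.
rewrite inE gP /=; move: (xg); rewrite inc_upd => /andP[_ /orP[/eqP gi|//]].
have ig : i \notin dom g by rewrite inE gi.
rewrite inc_updN // in xg; have e := partition_uniq pP fP gP xf xg.
by rewrite -e idf in ig.
Qed.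

(** As a member of [P] the enlarged subcube would overlap [f] without being [f]. Hence the union in
    [restr] is disjoint. *)
Lemma erase_notin_free i c P f :
  is_partition P -> f \in fixing i c P -> erase i f \notin free i P.
Proof.
move=> pP; rewrite inE => /andP[fP /eqP fi]; apply/negP.
rewrite in_free => /andP[eP _]; have [x xf] := inc_ex f.
have e := partition_uniq pP fP eP xf (inc_erase _ xf).
by have := congr1 (fun h : cube => h i) e; rewrite fi ffunE eqxx.
Qed.

Lemma erase_inj_fixing i c P : {in fixing i c P &, injective (erase i)}.
Proof.
move=> f g; rewrite !inE => /andP[_ /eqP fi] /andP[_ /eqP gi] e.
apply/ffunP => j; have := congr1 (fun h : cube => h j) e; rewrite !ffunE; case: eqP => // -> _.
by rewrite fi gi.
Qed.

(** * Counts along a coordinate and the q-ary Tarsi bound *)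

Lemma card_restr i c P : is_partition P ->
  #|restr i c P| = #|free i P| + #|fixing i c P|.
Proof.
move=> pP; rewrite cardsU card_in_imset; last exact: erase_inj_fixing.
rewrite (_ : _ :&: _ = set0) ?cards0 ?subn0 //; apply/setP => g; rewrite !in_setI in_set0.
apply/negP => /andP[gF /imsetP[f fB e]].
by have := erase_notin_free pP fB; rewrite -e gF.
Qed.

Lemma card_split i P : #|P| = #|free i P| + \sum_c #|fixing i c P|.
Proof.
rewrite -sum1_card (bigID (fun f => ~~ f i)) /=; congr (_ + _).
  by rewrite -sum1_card; apply: eq_bigl => f; rewrite inE.
rewrite (partition_big (fun f => odflt c0 (f i)) xpredT) //=.
apply: eq_bigr => c _; rewrite -sum1_card; apply: eq_bigl => f; rewrite inE -andbA.
by case: (f \in P) => //=; case: (f i) => [d|].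
Qed.

(** The coordinates that occur in the branch i = c but in no subcube free in [i]. *)
Definition news i c P := vars (restr i c P) :\: vars (free i P).


(** The Hall-type strengthening of |P| > (q - 1) |vars P|, which is the case F = set0;
    unlike that case it survives the induction on the number of coordinates. *)
Definition hall P := forall F, F \subset P -> F != P ->
  #|A|.-1 * #|vars P :\: vars F| < #|P :\: F|.

Lemma card_bigcup_leq (J T : finType) (p : pred J) (F : J -> {set T}) :
  #|\bigcup_(k | p k) F k| <= \sum_(k | p k) #|F k|.
Proof.
elim/big_rec2: _ => [|k n X _ h]; first by rewrite cards0.
by apply: leq_trans (leq_card_setU _ _) _; rewrite leq_add2l.
Qed.

Lemma sub_free i P F : F \subset P -> i \notin vars F -> F \subset free i P.
Proof.
move=> /subsetP FP iF; apply/subsetP => f fF; rewrite in_free (FP f fF) /=.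
by apply: contra iF => fi; apply/varsP; exists f.
Qed.

(** The subcubes free in [i] are shared by all branches, so only one branch, [c1], is
    charged for their coordinates. *)
Lemma vars_cover P F i c1 : F \subset free i P ->
  (vars P :\: vars F) :\ i \subset
  (vars (restr i c1 P) :\: vars F) :|: \bigcup_(c | c != c1) news i c P.
Proof.
move=> FP; apply/subsetP => j; rewrite in_setD1 in_setD => /and3P[ji jF jP].
have [jfree|jfree] := boolP (j \in vars (free i P)).
  by apply/setUP; left; rewrite in_setD jF (subsetP (varsS (free_sub_restr i c1 P))).
have [f fP jf] := varsP _ _ jP.
have : f \notin free i P by apply: contra jfree => h; apply/varsP; exists f.
rewrite in_free fP negbK /= => /domP[c fc].
have jE : j \in vars (restr i c P).
  by apply: (mem_vars_restr (f := f)) => //; rewrite inE fP fc eqxx.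
apply/setUP; have [<-|cc1] := eqVneq c c1; first by left; rewrite in_setD jF.
by right; apply/bigcupP; exists c; rewrite // in_setD jfree.
Qed.

Lemma sum1_neq c1 : \sum_(c : A | c != c1) 1 = #|A|.-1.
Proof. by rewrite sum1_card -(cardC1 c1); apply: eq_card => c; rewrite !inE. Qed.

(** Branch [c1] is measured relative to [F], every other branch relative to [free i P]. The summand
    [#|A|] collects one unit from each of these strict inequalities. *)
Lemma split_bound_step P F i c1 : is_partition P -> F \subset free i P ->
  i \in vars P -> (forall c, hall (restr i c P)) ->
  #|A|.-1 * (#|vars (restr i c1 P) :\: vars F| + \sum_(c | c != c1) #|news i c P|)
    + #|A| <= #|P :\: F|.
Proof.
move=> pP Ff iP H.
have fix_gt0 c : 0 < #|fixing i c P|.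
  by have [f fB] := fixing_ex c pP iP; apply/card_gt0P; exists f.
have Fle := subset_leq_card Ff.
have FP : F \subset P by apply: subset_trans Ff (free_sub i P).
have Fr c : F \subset restr i c P := subset_trans Ff (free_sub_restr i c P).
have cardr c := card_restr i c pP.
have H1 : #|A|.-1 * #|vars (restr i c1 P) :\: vars F| < #|restr i c1 P :\: F|.
  apply: H => //; apply/eqP => e; have := cardr c1; rewrite -e.
  by have := fix_gt0 c1; lia.
have H2 c : #|A|.-1 * #|news i c P| < #|fixing i c P|.
  have := H c (free i P) (free_sub_restr i c P).
  rewrite (cardsDS (free_sub_restr i c P)) cardr addKn; apply.
  by apply/eqP => e; have := cardr c; rewrite -e; have := fix_gt0 c; lia.
have H3 : \sum_(c | c != c1) (#|A|.-1 * #|news i c P| + 1) <=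
          \sum_(c | c != c1) #|fixing i c P|.
  by apply: leq_sum => c _; rewrite addn1.
move: H1 H3; rewrite (cardsDS FP) (cardsDS (Fr c1)) cardr (card_split i P) [\sum_c #|fixing i c P|](bigD1 c1) //=.
rewrite big_split /= -big_distrr /= sum1_neq.
have : 0 < #|A| by apply/card_gt0P; exists c1.
rewrite mulnDr.
set S := \sum_(c | _) #|fixing _ _ _|; set T := #|A|.-1 * \sum_(c | _) _.
set U := #|A|.-1 * _.
clearbody S T U; move: Fle; move: #|F| #|free i P| #|fixing i c1 P| #|A| => x y z t. lia.
Qed.

(** Split at a coordinate [i] of [P] outside [vars F]: [F] survives in each branch, and the branches
    have fewer coordinates. Of the surplus [#|A|] in [split_bound_step], [#|A|.-1] pays for [i] and
    1 for strictness. *)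
Lemma hall_partition P : is_partition P -> hall P.
Proof.
have [n] := ubnP #|vars P|; elim: n P => // n IHn P; rewrite ltnS => leP pP F FP FnP.
have [->|[i]] := set_0Vmem (vars P :\: vars F).
  rewrite cards0 muln0 card_gt0 setD_eq0.
  by apply: contra FnP => PF; rewrite eqEsubset FP PF.
rewrite in_setD => /andP[iF iP]; have Ff := sub_free FP iF.
apply: leq_trans (split_bound_step c0 pP Ff iP _); last first.
  move=> c; apply: IHn (is_partition_restr i c pP).
  exact: leq_trans (card_vars_restr c iP) leP.
have := leq_trans (subset_leq_card (vars_cover c0 Ff)) (leq_card_setU _ _).
have := card_bigcup_leq (fun c => c != c0) (news i ^~ P).
rewrite (cardsD1 i (vars P :\: vars F)) in_setD iF iP /=.
have : 0 < #|A| by apply/card_gt0P; exists c0.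
case: #|A| => // t _ h1 h2; rewrite /= mulnDr muln1 addnS ltnS addnC leq_add2r.
by rewrite leq_mul2l (leq_trans h2) ?orbT ?leq_add2l.
Qed.

Lemma split_bound P F i c1 : is_partition P -> F \subset free i P ->
  i \in vars P ->
  #|A|.-1 * (#|vars (restr i c1 P) :\: vars F| + \sum_(c | c != c1) #|news i c P|)
    + #|A| <= #|P :\: F|.
Proof.
move=> pP Ff iP; apply: split_bound_step => // c.
exact/hall_partition/is_partition_restr.
Qed.

Lemma vars0 : vars set0 = set0.
Proof. by rewrite /vars big_set0. Qed.

Lemma vars_bound P : is_partition P -> #|A|.-1 * #|vars P| < #|P|.
Proof.
move=> pP; have [f fP _] := partition_ex [ffun=> c0] pP.
have := hall_partition pP (sub0set P); rewrite vars0 !setD0; apply.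
by apply/eqP => e; rewrite -e inE in fP.
Qed.

(** * Extremal partitions: equality in [vars_bound] *)

Definition extremal P := #|P| == (#|A|.-1 * #|vars P|).+1.

Hypothesis A_gt1 : 1 < #|A|.

Lemma ex_neq c : exists d, d != c.
Proof.
have /card_gt1P[x [y [_ _ xy]]] := A_gt1.
by have [e|] := eqVneq x c; [exists y; rewrite -e eq_sym | exists x].
Qed.

(** Otherwise [split_bound] counts [j] twice, and so exceeds by one coordinate what covering
    [vars P] requires; equality in [vars_bound] leaves no room for that. *)
Lemma extremal_disjoint P i c c' j : is_partition P -> extremal P -> i \in vars P ->
  c != c' -> j \in news i c P -> j \notin vars (restr i c' P).
Proof.
move=> pP /eqP eP iP cc' jc; apply/negP => jc'.
have := split_bound c' pP (sub0set _) iP; rewrite vars0 !setD0 eP.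
have sub : vars P :\ i \subset vars (restr i c' P) :|:
    (\bigcup_(d | d != c') (if d == c then news i d P :\ j else news i d P)).
  apply/subsetP => k kP; have := subsetP (vars_cover c' (sub0set (free i P))) k.
  rewrite vars0 !setD0 => /(_ kP) /setUP[kr|/bigcupP[d dc' kd]]; first by apply/setUP; left.
  have [->|kj] := eqVneq k j; first by apply/setUP; left.
  by apply/setUP; right; apply/bigcupP; exists d => //; case: ifP; rewrite ?in_setD1 ?kj.
have := leq_trans (subset_leq_card sub) (leq_card_setU _ _).
have := card_bigcup_leq (fun d => d != c')
  (fun d => if d == c then news i d P :\ j else news i d P).
have -> : \sum_(d | d != c') #|if d == c then news i d P :\ j else news i d P| =
    #|news i c P :\ j| + \sum_(d | (d != c') && (d != c)) #|news i d P|.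
  by rewrite (bigD1 c) //= eqxx; congr (_ + _); apply: eq_bigr => d /andP[_ /negbTE->].
rewrite [\sum_(d | d != c') #|news i d P|](bigD1 c) //=.
rewrite (cardsD1 j (news i c P)) jc (cardsD1 i (vars P)) iP /=.
set S := \sum_(d | _) #|_|; set T := \bigcup_(d | _) _.
case: #|A| A_gt1 => // -[] // t _ h1 h2 /=; rewrite addnS ltnS.
rewrite (mulnDr _ 1) muln1 [t.+1 + _ * #|_|]addnC leq_add2r leq_mul2l /= -addnA add1n addnS => h3.
by have := leq_trans h3 (leq_trans h2 (leq_add (leqnn _) h1)); rewrite ltnn.
Qed.

Definition roots P := [set i | [forall f in P, i \in dom f]].

Lemma rootsP P i : reflect {in P, forall f, i \in dom f} (i \in roots P).
Proof. by rewrite inE; apply: forall_inP. Qed.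

(** Nothing is free in the root [i], so another root [j] would be new in two branches at once,
    against [extremal_disjoint]. *)
Lemma extremal_root_uniq P i j : is_partition P -> extremal P ->
  i \in roots P -> j \in roots P -> i = j.
Proof.
move=> pP eP /rootsP iP /rootsP jP; apply/eqP/contraT => ij.
have [f0 f0P _] := partition_ex [ffun=> c0] pP.
have iV : i \in vars P by apply/varsP; exists f0; rewrite ?iP.
have [c cc0] := ex_neq c0.
have jE d : j \in vars (restr i d P).
  have [f fB] := fixing_ex d pP iV; apply: (mem_vars_restr fB); rewrite 1?eq_sym //.
  by apply: jP; move: fB; rewrite inE => /andP[].
have := @extremal_disjoint P i c c0 j pP eP iV cc0; rewrite jE; apply.
rewrite in_setD jE andbT; apply/varsP => -[f]; rewrite in_free => /andP[fP].
by rewrite iP.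
Qed.

Lemma inc_sub_dom f g : (forall x, inc x f -> inc x g) -> dom g \subset dom f.
Proof.
move=> h; apply/subsetP => i /domP[c gi]; apply/contraT => /domNP fi.
have [x xf] := inc_ex f.
have [d dc] := ex_neq c.
have : inc (upd x i d) g by apply: h; rewrite inc_updN // inE fi.
by move=> /incP /(_ _ _ gi); rewrite ffunE eqxx => e; rewrite e eqxx in dc.
Qed.


(** Prepares the induction for a root: a branch that is again extremal and adds a single subcube to
    those free in [i]. *)
Lemma extremal_leaf P : is_partition P -> extremal P -> vars P != set0 ->
  exists2 i, i \in vars P & exists2 c, #|fixing i c P| = 1 & extremal (restr i c P).
Proof.
move=> pP eP /set0Pn[i1 i1P].
have [i iP' imin] := arg_minnP (fun i => #|P| - #|free i P|) i1P.
have iP : i \in vars P := iP'; exists i => //.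
(* A coordinate in [news i c P] is fixed only in subcubes with i = c, hence in strictly
   fewer subcubes than [i], against the choice of [i]. *)
have new0 c : news i c P = set0.
  apply/eqP/contraT => /set0Pn[j jc]; have := jc.
  rewrite in_setD => /andP[jfree /(subsetP (vars_restr _ _ _))].
  rewrite in_setD1 => /andP[ji jP].
  have [c'] := ex_neq c; rewrite eq_sym => cc'.
  have sub : free i P \proper free j P.
    apply/properP; split.
      apply/subsetP => f fi; have := fi; rewrite !in_free => /andP[-> _] /=.
      by apply: contra jfree => jf; apply/varsP; exists f.
    have [f fB] := fixing_ex c' pP iP; exists f.
      have fP : f \in P by move: fB; rewrite inE => /andP[].
      rewrite in_free fP /=; apply: contra (extremal_disjoint pP eP iP cc' jc).
      by move=> jf; apply: (mem_vars_restr fB).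
    by move: fB; rewrite !inE => /andP[-> /eqP->].
  have := imin j jP; have := proper_card sub.
  have := subset_leq_card (free_sub j P); lia.
have fix_gt0 c : 0 < #|fixing i c P|.
  by have [f fB] := fixing_ex c pP iP; apply/card_gt0P; exists f.
(* As [news] is empty, [vars_cover] puts every coordinate but [i] in each branch. *)
have E c : #|vars (restr i c P)| = #|vars P|.-1.
  rewrite (cardsD1 i (vars P)) iP /=; apply: eq_card => j; apply/idP/idP.
    exact/(subsetP (vars_restr _ _ _)).
  move=> jP; have := subsetP (vars_cover c (sub0set (free i P))) j.
  rewrite vars0 !setD0 => /(_ jP) /setUP[//|/bigcupP[d _]].
  by rewrite new0 inE.
have V0 : 0 < #|vars P| by apply/card_gt0P; exists i.
have [c cc0] := ex_neq c0.
have sum_ge : #|A|.-1 <= \sum_(d | d != c0) #|fixing i d P|.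
  by rewrite -(sum1_neq c0); apply: leq_sum.
have sum_ge' : #|fixing i c P| + #|A|.-1 <= (\sum_(d | d != c0) #|fixing i d P|).+1.
  rewrite -(sum1_neq c0) (bigD1 c) //= [X in _ <= X.+1](bigD1 c) //= addnCA addSn add0n ltnS.
  by rewrite leq_add2l; apply: leq_sum.
have Av : #|A|.-1 * #|vars P| = #|A|.-1 + #|A|.-1 * #|vars P|.-1.
  by rewrite -{1}(prednK V0) mulnS.
(* The bound for branch [c0] and one subcube for each other value already sum to [#|P|], so both are
   equalities. The bound for branch [c] and [fix_gt0 c0] then determine [#|free i P|]. *)
have [h1 h2] : #|fixing i c P| = 1 /\ #|free i P| = #|A|.-1 * #|vars P|.-1.
  have := vars_bound (is_partition_restr i c0 pP).
  have := vars_bound (is_partition_restr i c pP).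
  rewrite !card_restr // !E; move/eqP: eP; rewrite Av (card_split i P) (bigD1 c0) //=.
  move: sum_ge sum_ge' (fix_gt0 c0) (fix_gt0 c).
  move: #|fixing i c0 P| #|fixing i c P| #|free i P| (\sum_(d | _) _).
  move: (#|A|.-1 * #|vars P|.-1) #|A|.-1.
  lia.
by exists c => //; rewrite /extremal card_restr // E h1 h2 addn1.
Qed.

(** If every subcube fixes [i], then [i] is a root; otherwise a root [r] of the smaller extremal
    partition from [extremal_leaf] is also one of [P]. *)
Lemma extremal_root P : is_partition P -> extremal P -> vars P != set0 ->
  exists i, i \in roots P.
Proof.
have [n] := ubnP #|vars P|; elim: n P => // n IHn P; rewrite ltnS => leP pP eP VP.
have [i iP [c /eqP/cards1P[b Bb] eR]] := extremal_leaf pP eP VP.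
have bP : b \in fixing i c P by rewrite Bb inE.
have [free0|[a aF]] := set_0Vmem (free i P).
  exists i; apply/rootsP => f fP; apply/contraT => fi.
  have : f \in free i P by rewrite in_free fP.
  by rewrite free0 inE.
have pR := is_partition_restr i c pP.
have [||r /rootsP rR] := IHn _ _ pR eR.
- exact: leq_trans (card_vars_restr c iP) leP.
(* Without fixed coordinates the restricted partition would be a single subcube, but [a] and
   [erase i b] are distinct members. *)
- apply/negP => /eqP V0; have [x xb] := inc_ex (erase i b).
  have aR : a \in restr i c P by apply: (subsetP (free_sub_restr i c P)).
  have bR : erase i b \in restr i c P by apply/setUP; right; apply: imset_f.
  have xa : inc x a.
    apply/incP => j d aj; have : j \in vars (restr i c P); last by rewrite V0 inE.
    by apply/varsP; exists a; rewrite // inE aj.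
  have := erase_notin_free pP bP; rewrite (partition_uniq pR bR aR xb xa).
  by rewrite aF.
exists r; apply/rootsP => f fP.
have [fi|] := boolP (i \in dom f); last first.
  move=> fi; apply: rR; apply: (subsetP (free_sub_restr i c P)).
  by rewrite in_free fP.
have rb : r \in dom (erase i b) by apply: rR; apply/setUP; right; apply: imset_f.
have ri : r != i by move: rb; rewrite dom_erase in_setD1 => /andP[].
suff : r \in dom (erase i f) by rewrite dom_erase in_setD1 => /andP[].
(* The subcubes fixing [i] project along [i] onto the complement of those free in [i]; in
   the branch i = c this complement is the single subcube [erase i b]. *)
apply: (subsetP (inc_sub_dom _) _ rb) => x xf.
have [g gR xg] := partition_ex x pR.
move: gR => /setUP[gF|]; last by rewrite Bb imset_set1 inE => /eqP <-.
have [d fd] := domP _ _ fi.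
have gi : i \notin dom g by move: gF; rewrite in_free => /andP[].
have gP := subsetP (free_sub i P) _ gF.
have xg' : inc (upd x i d) g by rewrite inc_updN.
have xf' : inc (upd x i d) f by rewrite inc_upd xf fd eqxx orbT.
by move: gi; rewrite -(partition_uniq pP fP gP xf' xg') fi.
Qed.


(** * Partitions of uniform codimension and their decomposition at a root *)

Definition parts (U : {set I}) m :=
  [set P | [&& is_partition P, [forall f in P, #|dom f| == m] & vars P \subset U]].

Lemma partsP U m P :
  reflect [/\ is_partition P, {in P, forall f, #|dom f| = m} & vars P \subset U]
          (P \in parts U m).
Proof.
rewrite inE; apply: (iffP and3P) => -[pP H sP]; split=> //.
  by move=> f fP; apply/eqP; apply: (forall_inP H).
by apply/forall_inP => f fP; rewrite H.
Qed.

Lemma card_inc f : #|[set x | inc x f]| * #|A| ^ #|dom f| = #|A| ^ #|I|.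
Proof.
pose F i : pred A := if f i is Some c then pred1 c else predT.
have -> : #|[set x | inc x f]| = #|family F|.
  apply: eq_card => x; rewrite inE.
  by apply/forallP/familyP => h i; have := h i; rewrite /F; case: (f i).
rewrite card_family foldrE big_map big_enum /= -prod_nat_const [X in _ * X]big_mkcond /=.
rewrite -big_split /= -prod_nat_const; apply: eq_bigr => i _.
by rewrite /F inE; case: (f i) => [c|] /=; rewrite ?card1 ?mul1n ?muln1.
Qed.

(** By volume: [card_inc] shows that each subcube holds the same fraction of all points. *)
Lemma card_parts U m P : P \in parts U m -> #|P| = #|A| ^ m.
Proof.
move=> /partsP[pP dP _]; have A0 : 0 < #|A| by apply: leq_trans A_gt1.
have e : \sum_(f in P) #|[set x | inc x f]| = #|A| ^ #|I|.
  rewrite -card_ffun -sum1_card.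
  under [LHS]eq_bigr => f _ do rewrite -sum1_card big_mkcond /=.
  rewrite exchange_big /=; apply: eq_bigr => x _.
  rewrite -big_mkcondr sum1_card; apply: etrans (eqP (forallP pP x)).
  by apply: eq_card => f; rewrite [RHS]inE unfold_in /= inE.
apply/eqP; rewrite -(eqn_pmul2r (m := #|A| ^ #|I|)) ?expn_gt0 ?A0 // -{2}e.
rewrite big_distrr -sum_nat_const /=; apply/eqP/eq_bigr => f fP.
by rewrite -(card_inc f) dP // mulnC.
Qed.

Definition glue i (Q : {ffun A -> {set cube}}) : {set cube} :=
  [set f : cube | if f i is Some c then erase i f \in Q c else false].

Lemma erase_inj i f g : f i = g i -> erase i f = erase i g -> f = g.
Proof.
move=> fg e; apply/ffunP => j; have := congr1 (fun h : cube => h j) e.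
by rewrite !ffunE; case: eqP => // ->.
Qed.

Lemma glue_restr i P : i \in roots P -> glue i [ffun c => restr i c P] = P.
Proof.
move=> /rootsP iP; apply/setP => f; rewrite inE; apply/idP/idP.
  case fi: (f i) => [c|] //; rewrite ffunE => /restrP[g [gP gi] e].
  have /domP[d gd] := iP _ gP; move: gi; rewrite gd /= => /eqP dc.
  by rewrite (erase_inj _ e) // gd dc.
move=> fP; have /domP[c fc] := iP _ fP; rewrite fc ffunE.
by apply/restrP; exists f; rewrite ?fc ?eqxx ?orbT.
Qed.

Lemma restr_glue i c (Q : {ffun A -> {set cube}}) :
  i \notin vars (Q c) -> restr i c (glue i Q) = Q c.
Proof.
move=> iQ; apply/setP => g; apply/restrP/idP => [[f [fQ fi] ->]|gQ].
  move: fQ fi; rewrite inE; case: (f i) => [d|] // fQ /eqP[dc].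
  by rewrite -dc.
have ig : i \notin dom g by apply: contra iQ => ig; apply/varsP; exists g.
pose f : cube := [ffun j => if j == i then Some c else g j].
have fi : f i = Some c by rewrite ffunE eqxx.
have e : erase i f = g.
  by apply/ffunP => j; rewrite !ffunE; case: eqP => // ->; rewrite (domNP ig).
by exists f; rewrite ?inE ?fi ?e ?eqxx ?orbT.
Qed.

Lemma restr_parts U m i c P :
  P \in parts U m.+1 -> i \in roots P -> restr i c P \in parts (U :\ i) m.
Proof.
move=> /partsP[pP dP sP] /rootsP iP; apply/partsP; split.
- exact: is_partition_restr.
- move=> _ /restrP[f [fP _] ->]; rewrite dom_erase; have := dP f fP.
  by rewrite (cardsD1 i) iP // => -[].
- exact: subset_trans (vars_restr _ _ _) (setSD _ sP).
Qed.

Lemma glue_parts U m i (Q : {ffun A -> {set cube}}) :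
  i \in U -> (forall c, Q c \in parts (U :\ i) m) ->
  glue i Q \in parts U m.+1 /\ i \in roots (glue i Q).
Proof.
move=> iU QP.
have iQ c : i \notin vars (Q c).
  have /partsP[_ _ sQ] := QP c; apply/negP => /(subsetP sQ).
  by rewrite !inE eqxx.
have gP f : f \in glue i Q -> exists2 c, f i = Some c & erase i f \in Q c.
  by rewrite inE; case fi: (f i) => [c|] // fQ; exists c.
split; last by apply/rootsP => f /gP[c fi _]; rewrite inE fi.
apply/partsP; split.
- apply: partitionP => [x|x f1 f2].
    have /partsP[pQ _ _] := QP (x i); have [g] := partition_ex x pQ.
    rewrite -(restr_glue (iQ (x i))) => /restrP[f [fQ fi] ->] xf.
    exists f => //; have [c fc _] := gP _ fQ; move: fi; rewrite fc /= => /eqP[cx].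
    have <- : upd x i (x i) = x by apply/ffunP => j; rewrite ffunE; case: eqP => // ->.
    by rewrite inc_upd xf fc cx eqxx orbT.
  move=> /gP[c1 e1 q1] /gP[c2 e2 q2] x1 x2.
  have c1x := incP _ _ x1 _ _ e1; have c2x := incP _ _ x2 _ _ e2.
  have /partsP[pQ _ _] := QP (x i).
  apply: (erase_inj (i := i)); first by rewrite e1 e2 -c1x -c2x.
  by apply: (partition_uniq pQ) (inc_erase i x1) (inc_erase i x2); rewrite ?c1x // -c1x c2x.
- move=> f /gP[c fi fQ]; have /partsP[_ dQ _] := QP c.
  by rewrite (cardsD1 i) -dom_erase dQ // inE fi.
- apply/subsetP => j /varsP[f /gP[c fi fQ] jf]; have [->//|ji] := eqVneq j i.
  have /partsP[_ _ /subsetP/(_ j)] := QP c; rewrite in_setD1 ji; apply.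
  by apply/varsP; exists (erase i f); rewrite // dom_erase in_setD1 ji.
Qed.

(** At the root [i], the family of all [restr i c P] and [glue] are inverse to each other. *)
Lemma card_rooted U m i : i \in U ->
  #|[set P in parts U m.+1 | i \in roots P]| = #|parts (U :\ i) m| ^ #|A|.
Proof.
move=> iU; rewrite -(card_ffun_on A (mem (parts (U :\ i) m))).
pose h P : {ffun A -> {set cube}} := [ffun c => restr i c P].
rewrite -(card_in_imset (f := h)); last first.
  move=> P1 P2; rewrite inE => /andP[_ r1]; rewrite inE => /andP[_ r2] e.
  by rewrite -(glue_restr r1) -/(h P1) e glue_restr.
apply: eq_card => Q; apply/imsetP/ffun_onP => [[P]|QP].
  by rewrite inE => /andP[PP iP] -> c; rewrite ffunE restr_parts.
have [gP ig] := glue_parts iU QP; exists (glue i Q); first by rewrite inE gP.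
apply/ffunP => c; rewrite ffunE restr_glue //.
have /partsP[_ _ sQ] := QP c; apply/negP => /(subsetP sQ).
by rewrite !inE eqxx.
Qed.

Lemma sub_roots P f : f \in P -> roots P \subset dom f.
Proof. by move=> fP; apply/subsetP => i /rootsP; apply. Qed.

Lemma roots_sub U m P : P \in parts U m -> roots P \subset U /\ #|roots P| <= m.
Proof.
move=> /partsP[pP dP sP]; have [f fP _] := partition_ex [ffun=> c0] pP.
have rf := sub_roots fP; split; last by rewrite -(dP f fP) subset_leq_card.
apply: subset_trans rf (subset_trans _ sP).
by apply/subsetP => j jf; apply/varsP; exists f.
Qed.

(** Double counting of the pairs of a partition and one of its roots. *)
Lemma sum_roots U m :
  \sum_(P in parts U m.+1) #|roots P| = \sum_(i in U) #|parts (U :\ i) m| ^ #|A|.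
Proof.
under [RHS]eq_bigr => i iU do rewrite -(card_rooted m iU) -sum1_card.
rewrite (exchange_big_dep (mem (parts U m.+1))) /=; last first.
  by move=> i P _; rewrite inE => /andP[].
apply: eq_bigr => P PP; rewrite -sum1_card; apply: eq_bigl => i.
rewrite inE [P \in _]inE PP /= [i \in roots P]inE andb_idl //.
by move=> iP; apply: (subsetP (roots_sub PP).1); rewrite inE.
Qed.


(** * Partitions with few fixed coordinates, and the recursion *)

Lemma card_cubes_over U : #|[set f : cube | dom f \subset U]| = #|A|.+1 ^ #|U|.
Proof.
rewrite -card_option -(card_pffun_on None (mem U) predT).
apply: eq_card => f; rewrite inE; apply/idP/pffun_onP => [|[sf _]].
  move=> /subsetP sf; split; last by [].
  by apply/subsetP => i fi; apply: sf; rewrite inE; move: fi; rewrite unfold_in; case: (f i).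
by apply/subsetP => i /domP[c fi]; apply: (subsetP sf); rewrite unfold_in fi.
Qed.

(** The binomial expansion of [(1 + #|U|) ^ M] dominates the numbers of [k]-subsets term by term. *)
Lemma card_small_subsets U M :
  #|[set V : {set I} | V \subset U & #|V| <= M]| <= #|U|.+1 ^ M.
Proof.
rewrite -addn1 addnC expnDn.
apply: (@leq_trans (\sum_(k < M.+1) #|[set V : {set I} | V \subset U & #|V| == k]|)).
  apply: leq_trans (card_bigcup_leq xpredT _); apply/subset_leq_card/subsetP => V.
  rewrite inE => /andP[VU VM]; apply/bigcupP; exists (Ordinal (VM : #|V| < M.+1)) => //.
  by rewrite inE VU /=.
apply: leq_sum => k _; rewrite cards_draws exp1n mul1n.
apply: leq_trans (bin_leq_expn _ _) _.
by rewrite leq_pmull // bin_gt0 -ltnS.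
Qed.

(** Choose the set [V] of fixed coordinates, then [P] among the sets of subcubes over [V]; the
    number of the latter is bounded independently of [U]. *)
Lemma card_few_vars U m M :
  #|[set P in parts U m | #|vars P| <= M]| <= 2 ^ (#|A|.+1 ^ M) * #|U|.+1 ^ M.
Proof.
pose small := [set V : {set I} | V \subset U & #|V| <= M].
have h : [set P in parts U m | #|vars P| <= M] \subset
    \bigcup_(V in small) powerset [set f : cube | dom f \subset V].
  apply/subsetP => P; rewrite inE => /andP[/partsP[_ _ sP] cP].
  apply/bigcupP; exists (vars P); first by rewrite inE sP.
  rewrite powersetE; apply/subsetP => f fP; rewrite inE.
  by apply/subsetP => j jf; apply/varsP; exists f.
apply: leq_trans (subset_leq_card h) _; apply: leq_trans (card_bigcup_leq _ _) _.
rewrite mulnC; apply: leq_trans (_ : \sum_(V in small) 2 ^ (#|A|.+1 ^ M) <= _).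
  apply: leq_sum => V; rewrite inE => /andP[_ VM]; rewrite card_powerset card_cubes_over.
  by rewrite !leq_exp2l // ltnS; apply: leq_trans A_gt1.
by rewrite sum_nat_const leq_mul // card_small_subsets.
Qed.

(** So many coordinates are at least [nodes #|A| m.+1], the maximum that [vars_bound] allows; hence
    [P] is extremal. *)
Lemma card_roots_extremal U m P : P \in parts U m.+1 ->
  #|A| * nodes #|A| m < #|vars P| -> #|roots P| = 1.
Proof.
move=> PP MP; have /partsP[pP dP sP] := PP.
have A0 : 0 < #|A| by apply: leq_trans A_gt1.
have hP : #|P| = (#|A|.-1 * (#|A| * nodes #|A| m).+1).+1.
  by rewrite (card_parts PP) nodesE.
have eP : extremal P.
  rewrite /extremal hP; apply/eqP; congr (_ * _).+1; apply/eqP; rewrite eqn_leq MP /=.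
  have := vars_bound pP; rewrite hP ltnS leq_pmul2l //.
  by rewrite -ltnS prednK.
have [i iP] : exists i, i \in roots P.
  apply: extremal_root => //; apply/negP => /eqP V0.
  by rewrite V0 cards0 in MP.
apply/eqP/cards1P; exists i; apply/setP => j; rewrite in_set1.
by apply/idP/eqP => [jP|->//]; apply: extremal_root_uniq pP eP jP iP.
Qed.

(** [S] counts each partition once per root. The number of roots is 1 outside the class of
    [card_few_vars], and at most [m.+1] inside it. *)
Lemma parts_recursion U m (M := #|A| * nodes #|A| m) (C := 2 ^ (#|A|.+1 ^ M))
    (S := \sum_(i in U) #|parts (U :\ i) m| ^ #|A|) :
  #|parts U m.+1| <= S + C * #|U|.+1 ^ M /\
  S <= #|parts U m.+1| + m.+1 * C * #|U|.+1 ^ M.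
Proof.
rewrite /S -sum_roots; have := card_few_vars U m.+1 M; rewrite -/C.
set W := [set P in _ | _]; set Z := C * _ => hW.
have Wsum : \sum_(P in parts U m.+1) (P \in W : nat) = #|W|.
  rewrite -big_mkcondr sum1_card; apply: eq_card => P.
  by rewrite unfold_in [P \in W]inE andbA andbb.
rewrite -mulnA -/Z; split.
  apply: (@leq_trans (\sum_(P in parts U m.+1) (#|roots P| + (P \in W)))).
    rewrite -sum1_card; apply: leq_sum => P PP; rewrite inE PP /=.
    have := card_roots_extremal PP; rewrite -/M.
    by case: leqP => [_ _|_ -> //]; rewrite addn1.
  by rewrite big_split /= Wsum leq_add2l.
apply: (@leq_trans (\sum_(P in parts U m.+1) (1 + m.+1 * (P \in W)))).
  apply: leq_sum => P PP; rewrite inE PP /=.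
  have := card_roots_extremal PP; rewrite -/M.
  case: leqP => [_ _|_ -> //]; rewrite muln1.
  by apply: leq_trans (roots_sub PP).2 _; rewrite leq_addl.
by rewrite big_split /= -big_distrr /= Wsum sum1_card leq_add2l leq_mul2l hW orbT.
Qed.

Lemma parts0 U : parts U 0 = [set [set [ffun=> None]]].
Proof.
have dom0 f : #|dom f| = 0 -> f = [ffun=> None].
  move=> /eqP; rewrite cards_eq0 => /eqP d0; apply/ffunP => i; rewrite ffunE.
  by apply: domNP; rewrite d0 inE.
have domN : dom [ffun=> None] = set0 by apply/setP => i; rewrite !inE ffunE.
apply/setP => P; rewrite in_set1; apply/partsP/eqP => [[pP dP _]|->].
  have [f fP _] := partition_ex [ffun=> c0] pP.
  apply/setP => g; rewrite in_set1; apply/idP/eqP => [/dP/dom0 //|->].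
  by rewrite -(dom0 f (dP f fP)).
split; last first.
- by rewrite /vars big_set1 domN sub0set.
- by move=> f; rewrite in_set1 => /eqP->; rewrite domN cards0.
apply: partitionP => [x|x f g]; last by rewrite !in_set1 => /eqP-> /eqP->.
by exists [ffun=> None]; rewrite ?in_set1 //; apply/incP => i c; rewrite ffunE.
Qed.

End Cubes.

(** * Uniform bounds, and the passage to [c_coord] *)

Section Bounds.
Import all_boot zify.
Set Implicit Arguments.
Unset Strict Implicit.

(** One [K] has to serve all [I] and [U]: for the limit, and for the induction, which passes to
    [U :\ i]. *)
Lemma parts_bounds (A : finType) (m : nat) : 1 < #|A| ->
  exists K, forall (I : finType) (U : {set I}),
    (#|U| - K) ^ nodes #|A| m <= #|parts A U m| <= (#|U| + K) ^ nodes #|A| m.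
Proof.
move=> A_gt1; have [c0 _] : exists c0 : A, c0 \in A.
  by apply/card_gt0P; apply: leq_trans A_gt1.
elim: m => [|m [K IHm]]; first by exists 0 => I U; rewrite (parts0 c0) cards1.
pose M := #|A| * nodes #|A| m; pose C := 2 ^ (#|A|.+1 ^ M).
(* The constants of [recursion_upper] and [recursion_lower], the latter with error coefficient
   [m.+1 * C]. *)
exists (maxn (K + C).+1 (2 * K + 3 + (m.+1 * C) * 2 ^ M)) => I U.
have [hu hl] := parts_recursion c0 A_gt1 U m.
have Uc i : i \in U -> #|U :\ i| = #|U|.-1 by move=> iU; rewrite (cardsD1 i U) iU.
apply/andP; split.
  apply: leq_trans (recursion_lower (K := K) _ hl); last first.
    rewrite -sum_nat_const; apply: leq_sum => i iU; rewrite mulnC expnM; apply: leq_expn.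
    by rewrite -(Uc i iU); have /andP[] := IHm _ (U :\ i).
  by apply: leq_expn; apply: leq_sub2l; apply: leq_maxr.
apply: leq_trans (recursion_upper (K := K) _ hu) _.
  rewrite -sum_nat_const; apply: leq_sum => i iU; rewrite mulnC expnM; apply: leq_expn.
  by rewrite -(Uc i iU); have /andP[] := IHm _ (U :\ i).
by apply: leq_expn; rewrite leq_add2l leq_maxl.
Qed.


Definition pts (I A : finType) (f : cube I A) : {set point I A} := [set x | inc x f].

(** With two letters the points determine the fixed coordinates, by [inc_sub_dom]; the values are
    read off any point. *)
Lemma pts_inj (I A : finType) : 1 < #|A| -> injective (@pts I A).
Proof.
move=> A_gt1 f g e; have [c0 _] : exists c0 : A, c0 \in A.
  by apply/card_gt0P; apply: leq_trans A_gt1.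
have efg x : inc x f = inc x g by have /setP/(_ x) := e; rewrite !inE.
have fg : dom f = dom g.
  apply/eqP; rewrite eqEsubset.
  by rewrite !(inc_sub_dom c0 A_gt1) // => x; rewrite efg.
have [x xf] := inc_ex c0 f; have xg := xf; rewrite efg in xg.
apply/ffunP => i; have [/domP[c fi]|fi] := boolP (i \in dom f); last first.
  by rewrite (domNP fi) domNP // -fg.
have /domP[d gi] : i \in dom g by rewrite -fg; apply/domP; exists c.
by rewrite fi gi -(incP _ _ xf _ _ fi) -(incP _ _ xg _ _ gi).
Qed.

Lemma is_subcubeP (q n m : nat) (c0 : 'I_q) (C : {set vec q n}) : m <= n ->
  reflect (exists2 f : cube 'I_n 'I_q, #|dom f| = m & C = pts f)
          (is_subcube q n (n - m) C).
Proof.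
move=> mn; apply: (iffP existsP) => [[S /existsP[a /andP[/eqP cS /eqP ->]]]|[f df ->]].
  exists [ffun i => if i \in S then Some (a i) else None].
    have <- : #|S| = m by move: cS mn; lia.
    by apply: eq_card => i; rewrite inE ffunE; case: (i \in S).
  apply/setP => x; rewrite !inE; apply/forall_inP/incP => [h i c|h i iS].
    by rewrite ffunE; case: ifP => // /h/eqP -> [].
  by apply/eqP; apply: h; rewrite ffunE iS.
have [a af] := inc_ex c0 f; exists (dom f); apply/existsP; exists a.
rewrite df subnKC // eqxx; apply/eqP/setP => x; rewrite !inE.
apply/incP/forall_inP => [h i /domP[c fi]|h i c fi].
  by rewrite (h _ _ fi) (incP _ _ af _ _ fi).
have /h/eqP -> : i \in dom f by apply/domP; exists c.
exact: (incP _ _ af).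
Qed.

(** [pts] carries encoded partitions bijectively to partitions into point sets, and [card_parts]
    supplies the size [q ^ m]. *)
Lemma c_coord_parts (q n m : nat) : 1 < q -> m <= n ->
  c_coord q n m = #|parts 'I_q [set: 'I_n] m|.
Proof.
move=> q_gt1 mn; have A_gt1 : 1 < #|'I_q| by rewrite card_ord.
pose c0 : 'I_q := Ordinal (ltnW q_gt1).
have pinj := @pts_inj 'I_n 'I_q A_gt1.
rewrite -(card_imset _ (imset_inj pinj)) /c_coord; apply: eq_card => Q.
have cover (P : {set cube 'I_n 'I_q}) x :
    #|[set C in [set pts f | f in P] | x \in C]| = #|[set f in P | inc x f]|.
  rewrite -(card_imset _ pinj); apply: eq_card => C; rewrite inE.
  apply/andP/imsetP => [[/imsetP[f fP ->]]|[f]].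
    by rewrite inE => xf; exists f; rewrite // inE fP.
  by rewrite inE => /andP[fP xf] ->; rewrite inE imset_f.
rewrite inE; apply/and3P/imsetP => [[/eqP cQ /forall_inP sQ /forallP pQ]|[P PP ->]].
  have dQ f : pts f \in Q -> #|dom f| = m.
    by move=> /sQ /(is_subcubeP c0 _ mn)[g dg /pinj ->].
  have eQ : Q = [set pts f | f in [set f | pts f \in Q]].
    apply/setP => C; apply/idP/imsetP => [CQ|[f]]; last by rewrite inE => fQ ->.
    by have /(is_subcubeP c0 _ mn)[f _ e] := sQ _ CQ; exists f; rewrite // inE -e.
  exists [set f | pts f \in Q] => //; apply/partsP; split; last exact: subsetT.
    by apply/forallP => x; rewrite -cover -eQ; apply: pQ.
  by move=> f; rewrite inE; apply: dQ.
have /partsP[pP dP _] := PP; split.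
- by rewrite card_imset // (card_parts A_gt1 PP) card_ord.
- apply/forall_inP => _ /imsetP[f fP ->]; apply/(is_subcubeP c0 _ mn).
  by exists f; rewrite ?dP.
- by apply/forallP => x; rewrite cover; have /forallP := pP.
Qed.


Lemma expn_pow a b : a ^ b = Nat.pow a b.
Proof. by elim: b => // b IHb; rewrite expnS IHb. Qed.

Lemma nodes_div q m : 1 < q ->
  Nat.div (Nat.sub (Nat.pow q m) 1) (Nat.sub q 1) = nodes q m.
Proof.
case: q => // q q_gt1; rewrite -expn_pow nodesE //= !Nat.sub_0_r.
by rewrite mulnC; apply: Nat.div_mul => q0; rewrite q0 in q_gt1.
Qed.

Lemma c_coord_bounds (q m : nat) : Peano.le 2 q ->
  exists K, forall n, Peano.le m n ->
    Peano.le (Nat.pow (Nat.sub n K) (nodes q m)) (c_coord q n m) /\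
    Peano.le (c_coord q n m) (Nat.pow (Nat.add n K) (nodes q m)).
Proof.
move=> /leP q_gt1; have [|K HK] := @parts_bounds 'I_q m; first by rewrite card_ord.
exists K => n /leP mn; have := HK _ [set: 'I_n].
rewrite -c_coord_parts // cardsT !card_ord -!expn_pow => /andP[h1 h2].
by split; apply/leP.
Qed.

End Bounds.

(** * The limit, by squeezing *)

Import Coquelicot.Coquelicot.
Open Scope R_scope.

Lemma is_lim_seq_ratio_pow (u : nat -> R) (N : nat) :
  is_lim_seq (fun n => u n / INR n) 1 ->
  is_lim_seq (fun n => u n ^ N / INR n ^ N) 1.
Proof.
  intros H; induction N as [|N IH].
  - apply is_lim_seq_ext with (fun _ => 1); [|apply is_lim_seq_const].
    intros n; simpl; field.
  - apply is_lim_seq_ext with (fun n => u n / INR n * (u n ^ N / INR n ^ N)).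
    + intros n; unfold Rdiv; simpl; rewrite Rinv_mult; ring.
    + replace (Finite 1) with (Finite (1 * 1)) by (f_equal; ring).
      now apply is_lim_seq_mult'.
Qed.

Lemma is_lim_seq_shift_ratio (k : R) : is_lim_seq (fun n => (INR n + k) / INR n) 1.
Proof.
  apply is_lim_seq_ext_loc with (fun n => 1 + k * / INR n).
  - exists 1%nat; intros n Hn; field; apply not_0_INR; lia.
  - replace (Finite 1) with (Finite (1 + k * 0)) by (f_equal; ring).
    apply is_lim_seq_plus'; [apply is_lim_seq_const|].
    apply is_lim_seq_mult'; [apply is_lim_seq_const|].
    replace (Finite 0) with (Rbar_inv p_infty) by reflexivity.
    apply is_lim_seq_inv; [apply is_lim_seq_INR | easy].
Qed.

Lemma sandwich_asymptotic (c : nat -> nat) (m K N : nat) :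
  (forall n, (m <= n)%nat -> ((n - K) ^ N <= c n)%nat /\ (c n <= (n + K) ^ N)%nat) ->
  Un_cv (fun n => INR (c n) / INR n ^ N) 1.
Proof.
  intros H; apply is_lim_seq_Reals.
  apply is_lim_seq_le_le_loc with
    (fun n => (INR n + - INR K) ^ N / INR n ^ N) (fun n => (INR n + INR K) ^ N / INR n ^ N).
  (* Beyond [m + K] the truncated difference [n - K] is a true one, and [n] is nonzero. *)
  - exists (S (m + K)); intros n Hn; destruct (H n) as [Hl Hu]; [lia|].
    apply le_INR in Hl, Hu; rewrite pow_INR in Hl, Hu.
    rewrite minus_INR in Hl by lia; rewrite plus_INR in Hu.
    assert (0 < / INR n ^ N) by (apply Rinv_0_lt_compat, pow_lt, lt_0_INR; lia).
    split; apply Rmult_le_compat_r; (exact Hl || exact Hu || lra).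
  - apply is_lim_seq_ratio_pow, is_lim_seq_shift_ratio.
  - apply is_lim_seq_ratio_pow, is_lim_seq_shift_ratio.
Qed.

Theorem theorem6 (q m : nat) (hq : (2 <= q)%nat) (hm : (1 <= m)%nat) :
  Un_cv (fun n : nat =>
           INR (c_coord q n m) / INR n ^ Nat.div (q ^ m - 1) (q - 1)) 1.
Proof.
  rewrite nodes_div by (apply (ssrbool.introT ssrnat.leP); exact hq).
  destruct (c_coord_bounds m hq) as [K HK].
  exact (sandwich_asymptotic HK).
Qed.
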